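(* In the real (resp. complex) projective 3-space, let $f_{12},f_{13},f_{14},f_{23},f_{24},f_{34}$ be six points and let $f_1,f_2,f_3,f_4,f_{123},f_{124},f_{134},f_{234}$ be eight planes such that the 12 tiles with vertices labeled in cyclic order by $$(f_i,f_{ij},f_{ijk},f_{ik}),\qquad i\in\{1,2,3,4\},\ \{j,k\}\subset\{1,2,3,4\}\setminus\{i\},\ j\neq k,$$ are coherent and the 14 inputs $f_i,f_{ij},f_{ijk}$ are generic subject to these conditions. Then there exist unique points $f$ and $f_{1234}$ that make all tiles of the 4-dimensional cube coherent, i.e. such that, in addition, the six tiles $(f,f_i,f_{ij},f_j)$, $1\le i<j\le4$, and the six tiles $(f_{ij},f_{ijk},f_{1234},f_{ij\ell})$, $\{i,j,k,\ell\}=\{1,2,3,4\}$, are coherent.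
   Context: Conventions: $f_{ij}=f_{ji}$, $f_{ijk}=f_{jik}=f_{ikj}=\cdots$. A tile with vertices labeled cyclically by $A,\ell,B,m$, where $A,B$ are points and $\ell,m$ are planes in projective 3-space, is coherent if neither $A$ nor $B$ lies on $\ell$ or $m$, and either $A=B$, or $\ell=m$, or the line through $A$ and $B$ intersects the line $\ell\cap m$. The notion does not depend on which vertex is listed first or on the direction of listing. The labels $f_I$ are placed at the vertices of the 4-cube indexed by subsets $I\subset\{1,2,3,4\}$ ($f=f_\varnothing$); tiles are the 2-dimensional faces. ''Generic'' means belonging to a suitable Zariski dense (concretely, nonempty Zariski open) subset of the space of configurations satisfying the stated conditions. *)

(* Defs.v *)
From mathcomp Require Import all_boot all_order all_algebra.
From mathcomp Require Import reals complex.
From mathcomp Require Import mpoly.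

Set Implicit Arguments.
Unset Strict Implicit.
Unset Printing Implicit Defensive.

Import GRing.Theory.
Local Open Scope ring_scope.

Section Cube.
Variable K : fieldType.

(* A projective subspace of P^3 is a linear subspace of K^4: points have
   dimension 1 and planes have dimension 3, so that [A + B] is the line through
   the points A != B, [l :&: m] is the line common to the planes l != m, and two
   projective subspaces intersect iff their linear intersection is nonzero. *)
Definition psubspace : predArgType := {vspace 'rV[K]_4}.

Definition is_point (A : psubspace) : bool := \dim A == 1%N.
Definition is_plane (l : psubspace) : bool := \dim l == 3%N.

(* The tile with vertices labeled cyclically by A, l, B, m. *)
Definition coherent (A l B m : psubspace) : Prop :=
  [/\ ~~ (A <= l)%VS, ~~ (A <= m)%VS, ~~ (B <= l)%VS & ~~ (B <= m)%VS] /\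
  [\/ A = B, l = m | ((A + B) :&: (l :&: m))%VS <> 0%VS].

(* The vertices of the 4-cube are the subsets of 'I_4: points sit at the even
   ones and planes at the odd ones. *)
Definition labeling := {set 'I_4} -> psubspace.

(* The 2-face through I, I + j, I + j + k, I + k.  The vertices are listed
   starting from a point, i.e. from I + j when I carries a plane. *)
Definition face_coherent (f : labeling) (I : {set 'I_4}) (j k : 'I_4) : Prop :=
  if odd #|I| then coherent (f (j |: I)) (f (k |: (j |: I))) (f (k |: I)) (f I)
  else coherent (f I) (f (j |: I)) (f (k |: (j |: I))) (f (k |: I)).

Definition is_face (I : {set 'I_4}) (j k : 'I_4) : bool :=
  [&& j \notin I, k \notin I & j != k].

(* The 14 vertices carrying the inputs f_i, f_ij, f_ijk. *)
Definition input_vertex : predArgType :=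
  {I : {set 'I_4} | (I != set0) && (I != setT)}.

Definition inputs := input_vertex -> psubspace.

(* Six points and eight planes: the product of 14 projective 3-spaces. *)
Definition points_and_planes (c : inputs) : Prop :=
  forall v : input_vertex,
    if odd #|val v| then is_plane (c v) else is_point (c v).

(* The labeling of the cube with f = A, f_1234 = B and inputs c. *)
Definition extend (c : inputs) (A B : psubspace) : labeling := fun I =>
  if insub I is Some v then c v else if I == set0 then A else B.

(* The faces at the vertices {i} only involve input vertices, so the labels
   0 given to the two remaining vertices play no role. *)
Definition configuration (c : inputs) : Prop :=
  points_and_planes c /\
  forall (I : {set 'I_4}) (j k : 'I_4), #|I| = 1%N -> is_face I j k ->
    face_coherent (extend c 0%VS 0%VS) I j k.

Definition completes_cube (c : inputs) (AB : psubspace * psubspace) : Prop :=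
  [/\ is_point AB.1, is_point AB.2 &
      forall (I : {set 'I_4}) (j k : 'I_4), is_face I j k ->
        face_coherent (extend c AB.1 AB.2) I j k].

(* The plane u_0 x_0 + u_1 x_1 + u_2 x_2 + u_3 x_3 = 0. *)
Definition plane_of (u : 'rV[K]_4) : psubspace :=
  lker (linfun (mulmxr u^T)).

Definition homogeneous_coordinates
    (c : inputs) (x : input_vertex -> 'rV[K]_4) : Prop :=
  forall v : input_vertex, x v != 0 /\
    c v = if odd #|val v| then plane_of (x v) else <[x v]>%VS.

(* Polynomials in the 14 * 4 homogeneous coordinates. *)
Definition coordinate_poly :=
  {mpoly K[#|{: input_vertex * 'I_4}|]}.

Definition eval_at (x : input_vertex -> 'rV[K]_4) (g : coordinate_poly) : K :=
  g.@[fun n => let: (v, s) := enum_val n in x v 0 s].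

(* Zariski closed subsets of the product of 14 projective 3-spaces.  The
   polynomials need not be multihomogeneous: over an infinite field, g vanishes
   at all the homogeneous coordinates of c iff all the multihomogeneous
   components of g vanish at c. *)
Definition zariski_closed (Z : inputs -> Prop) : Prop :=
  exists S : seq coordinate_poly, forall c, points_and_planes c ->
    (Z c <-> forall x, homogeneous_coordinates c x ->
               forall g, g \in S -> eval_at x g = 0).

Definition zariski_open_in (V U : inputs -> Prop) : Prop :=
  exists2 Z, zariski_closed Z & forall c, U c <-> V c /\ ~ Z c.

End Cube.

(* Main.v *)
Require Import Defs.
From mathcomp Require Import all_boot all_order all_algebra.
From mathcomp Require Import reals complex.
From mathcomp Require Import boolp mpoly ring.

(** Write [<u, v>] for the dot product of two rows of length 4, so that the
    point spanned by [u] lies on the plane with equation [v] iff [<u, v> = 0].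
    With coordinates [A], [B] of two points and [l], [m] of two planes, a tile
    is coherent iff the four products around it are nonzero and
    [<A, l> <B, m> = <A, m> <B, l>] ([coherentP]).  In this form points and
    planes play the same role, and coherence of the cube says that the edge
    weights [<y_I, y_(I + j)>] form a nowhere zero multiplicative function on
    the edges which is balanced around every 2-face ([flat_face]).

    The three tiles that share the vertex [f_ijk] and have their opposite
    vertices at [f_i], [f_j], [f_k] give, after the three weights at [f_ijk]
    cancel, a relation between [f_i], [f_j], [f_k] and the three points between
    them ([flat_cocycle]): the ratios [<f_ij, f_i> / <f_ij, f_j>] satisfy the
    cocycle condition.  They are therefore of the form [s_i / s_j] for a family
    [s] of nonzero scalars, which is unique up to a common factor
    ([potential_exists], [potential_unique]).  The tiles at [f] are coherent iff
    the products [<f, f_i>] form such a family ([flat_cornerP]), so that [f] is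
    the solution of the linear system [<f, f_i> = s_i].  As soon as the four
    planes [f_i] are linearly independent, this system has one solution, and [f]
    is unique because a common factor of the [s_i] only rescales it
    ([flat_corner_exists]).

    Complementation of the index sets is a symmetry of the cube that exchanges
    [f] with [f_1234] and the planes [f_i] with the planes [f_jkl]; in
    coordinates it preserves the equations ([flat_face_setC]), so the same
    argument gives [f_1234] when the four planes [f_jkl] are independent.

    The generic set is thus the locus where the two determinants, of the [f_i]
    and of the [f_jkl], do not vanish.  It is nonempty: take all six points equal
    to [(1 : 1 : 1 : 1)] and let the planes [f_i], and the planes [f_jkl], be the
    four coordinate planes.  All this holds over every field. *)

Set Implicit Arguments.
Unset Strict Implicit.
Unset Printing Implicit Defensive.

Import GRing.Theory.
Local Open Scope ring_scope.

(** * Flat quadruples of vectors *)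

Section DotProduct.
Variables (K : fieldType) (n : nat).
Implicit Types u v w : 'rV[K]_n.

Definition dot u v : K := (u *m v^T) 0 0.

Lemma dotC u v : dot u v = dot v u.
Proof. by rewrite /dot !mxE; apply: eq_bigr => i _; rewrite !mxE mulrC. Qed.

Lemma dotDl u v w : dot (u + v) w = dot u w + dot v w.
Proof. by rewrite /dot mulmxDl mxE. Qed.

Lemma dotZl k u w : dot (k *: u) w = k * dot u w.
Proof. by rewrite /dot -scalemxAl mxE. Qed.

Lemma dot0l u : dot 0 u = 0.
Proof. by rewrite /dot mul0mx mxE. Qed.

(** The coordinate form of coherence of the tile with vertices [a], [b], [c],
    [d] in cyclic order; it does not distinguish points from planes. *)
Definition flat a b c d : Prop :=
  [/\ dot a b != 0, dot b c != 0, dot c d != 0, dot d a != 0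
    & dot a b * dot c d = dot b c * dot d a].

Lemma flat_rot a b c d : flat a b c d -> flat b c d a.
Proof. by case=> ab bc cd da e; split=> //; rewrite -e mulrC. Qed.

End DotProduct.

(** * Multiplicative potentials *)

Section Potential.
Variables (K : fieldType) (n : nat) (a : 'I_n.+1 -> 'I_n.+1 -> K).
Hypothesis a_neq0 : forall i j, i != j -> a i j != 0.

(** For each [i != j], [s i / s j] is the prescribed ratio [a i j / a j i]. *)
Definition potential (s : 'I_n.+1 -> K) : Prop :=
  (forall i, s i != 0) /\
  (forall i j, i != j -> s i * a j i = s j * a i j).

(** A cocycle is a coboundary: normalize [s 0 = 1], which forces the value of
    [s i] through the pair [i, 0]; the condition for a pair [i, j] is then the
    cocycle identity of the triple [i, j, 0]. *)
Lemma potential_exists :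
  (forall i j k, i != j -> j != k -> i != k ->
     a i j * a j k * a k i = a i k * a k j * a j i) ->
  exists s, potential s.
Proof.
move=> cocycle.
exists (fun i => if i == 0 then 1 else a i 0 / a 0 i); split=> [i|i j ij].
  case: (eqVneq i 0) => [_|i0]; first exact: oner_neq0.
  by rewrite mulf_neq0 ?invr_eq0 ?a_neq0 // eq_sym.
case: (eqVneq i 0) ij => [->|i0] ij.
  by rewrite eq_sym (negbTE ij) mul1r divfK ?a_neq0.
case: (eqVneq j 0) ij => [->|j0] ij.
  by rewrite mul1r divfK // a_neq0 // eq_sym.
have a0i : a 0 i != 0 by rewrite a_neq0 // eq_sym.
have a0j : a 0 j != 0 by rewrite a_neq0 // eq_sym.
have e := cocycle i j 0 ij j0 i0.
apply: (mulfI a0i); apply: (mulfI a0j).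
transitivity (a i 0 * a 0 j * a j i); first by field.
by rewrite -e; field.
Qed.

Lemma potential_unique s t i j :
  potential s -> potential t -> t i * s j = t j * s i.
Proof.
move=> [_ sP] [_ tP]; case: (eqVneq i j) => [->//|ij].
have aji : a j i != 0 by rewrite a_neq0 // eq_sym.
apply: (mulIf aji); rewrite mulrAC tP // -[RHS]mulrA sP //; ring.
Qed.

End Potential.

(** * Vectors with prescribed products against a basis *)

Section DualBasis.
Variables (K : fieldType) (n : nat) (l : 'I_n -> 'rV[K]_n).
Hypothesis l_basis : \matrix_i l i \in unitmx.

Let dotE p i : dot p (l i) = (p *m (\matrix_i l i)^T) 0 i.
Proof.
by rewrite /dot !mxE; apply: eq_bigr => j _; rewrite !mxE.
Qed.

Lemma dot_basis_solve (s : 'I_n -> K) : exists p, forall i, dot p (l i) = s i.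
Proof.
exists ((\row_i s i) *m invmx (\matrix_i l i)^T) => i.
by rewrite dotE mulmxKV ?unitmx_tr // mxE.
Qed.

Lemma dot_basis_inj p q : (forall i, dot p (l i) = dot q (l i)) -> p = q.
Proof.
move=> pq; have l_unit : (\matrix_i l i)^T \in unitmx by rewrite unitmx_tr.
apply: (can_inj (mulmxK l_unit)).
by apply/rowP => i; rewrite -!dotE.
Qed.

End DualBasis.

(** * The vertex completing a corner of the cube *)

Lemma cancel_around (K : comNzRingType) (a b c a' b' c' u v w : K) :
  a * w = u * a' -> b * u = v * b' -> c * v = w * c' ->
  a * b * c * u * v * w = a' * c' * b' * u * v * w.
Proof.
move=> e1 e2 e3; transitivity ((a * w) * (b * u) * (c * v)); first by ring.
by rewrite e1 e2 e3; ring.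
Qed.

Section Corner.
Variables (K : fieldType) (m : nat).
Let n := m.+3.
Variable y : {set 'I_n} -> 'rV[K]_n.

Definition flat_face (I : {set 'I_n}) (j k : 'I_n) : Prop :=
  flat (y I) (y (j |: I)) (y (k |: (j |: I))) (y (k |: I)).

(** The vector at the corner [set0] is an argument separate from [y], because it
    is the unknown while the other vertices are fixed. *)
Definition flat_corner (p : 'rV[K]_n) : Prop :=
  forall i j, i != j ->
    flat p (y [set i]) (y (j |: [set i])) (y [set j]).

(** Coherence of all the faces whose four vertices have indices of cardinal 1,
    2, 2 and 3. *)
Definition flat_middle : Prop :=
  forall i j k, i != j -> i != k -> j != k -> flat_face [set i] j k.

Hypothesis flat_singletons : flat_middle.

Let a i j := dot (y [set i]) (y [set i; j]).

Let flat_triple i j k : i != j -> i != k -> j != k ->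
  flat (y [set i]) (y [set i; j]) (y [set i; j; k]) (y [set i; k]).
Proof.
move=> ij ik jk; have := flat_singletons ij ik jk.
by rewrite /flat_face (setUC [set k]) (setUC [set k]) (setUC [set j]).
Qed.

(** Multiply the equations of the three faces at [[set i]], [[set j]] and
    [[set k]] that contain [[set i; j; k]]: each weight of an edge at
    [[set i; j; k]] occurs once on both sides, and what remains is the identity
    below. *)
Lemma flat_cocycle i j k : i != j -> j != k -> i != k ->
  a i j * a j k * a k i = a i k * a k j * a j i.
Proof.
move=> ij jk ik; rewrite /a.
have ji : j != i by rewrite eq_sym.
have ki : k != i by rewrite eq_sym.
have kj : k != j by rewrite eq_sym.
have [_ n1 _ _ e1] := flat_triple ij ik jk.
have [_ n2 _ _ e2] := flat_triple jk ji ki.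
have [_ n3 _ _ e3] := flat_triple ki kj ij.
have tj : [set j; k; i] = [set i; j; k] by rewrite setUC setUA.
have tk : [set k; i; j] = [set i; j; k] by rewrite -setUA setUC.
rewrite {}tj {}tk in n2 n3 e2 e3.
set t := y [set i; j; k] in n1 n2 n3 e1 e2 e3.
rewrite [[set k; i]]setUC ?[[set k; j]]setUC ?[[set j; i]]setUC.
rewrite [[set j; i]]setUC in e2.
rewrite [[set k; i]]setUC in n3 e3; rewrite [[set k; j]]setUC in e3.
rewrite (dotC t) [X in _ = _ * X]dotC in e1.
rewrite (dotC t) [X in _ = _ * X]dotC in e2.
rewrite (dotC t) [X in _ = _ * X]dotC in e3.
apply: (mulIf n1); apply: (mulIf n2); apply: (mulIf n3).
by apply: cancel_around e1 e2 e3.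
Qed.

Let third_index i j : exists k : 'I_n, (i != k) && (j != k).
Proof.
have /card_gt0P[k] : (0 < #|~: [set i; j]|)%N.
  by rewrite cardsCs setCK card_ord subn_gt0 cards2; case: (i != j).
by rewrite !inE negb_or => /andP[ki kj]; exists k; rewrite eq_sym ki eq_sym.
Qed.

Lemma incidence_neq0 i j : i != j -> a i j != 0.
Proof.
move=> ij; have [k /andP[ik jk]] := third_index i j.
by have [] := flat_triple ij ik jk.
Qed.

(** The face of [[set i; j]] reads
    [<p, y_i> <y_ij, y_j> = <y_i, y_ij> <y_j, p>]. *)
Lemma flat_cornerP p :
  flat_corner p <-> potential a (fun i => dot p (y [set i])).
Proof.
split=> [pP|[p_neq0 pE] i j ij].
  split=> [i|i j ij].
    by have [j /andP[ij _]] := third_index i i; have [] := pP i j ij.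
  have [_ _ _ _] := pP i j ij.
  by rewrite /a (setUC [set j]) [X in _ * X]dotC => ->; rewrite [RHS]mulrC (dotC p).
have ji : j != i by rewrite eq_sym.
have := incidence_neq0 ij; have := incidence_neq0 ji.
rewrite /flat /a (dotC _ p) (dotC _ (y [set j])) (setUC [set j]) => aji aij.
split=> //; have := pE i j ij; rewrite /a (setUC [set j]) => ->.
exact: mulrC.
Qed.

(** The potential of the cocycle is prescribed as the products of [p] with the
    basis.  Another solution gives a proportional potential, so it is
    proportional to [p]. *)
Lemma flat_corner_exists : \matrix_i y [set i] \in unitmx ->
  exists p, flat_corner p /\ forall q, flat_corner q -> exists k, q = k *: p.
Proof.
move=> basis.
have [s sP] := potential_exists incidence_neq0 flat_cocycle.
have [p pE] := dot_basis_solve basis s.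
have {}sP : potential a (fun i => dot p (y [set i])).
  by case: sP => s0 sE; split=> [i|i j]; rewrite !pE //; apply: sE.
exists p; split; first exact/flat_cornerP.
move=> q /flat_cornerP qP.
exists (dot q (y [set ord0]) / dot p (y [set ord0])).
apply: (dot_basis_inj basis) => i; rewrite dotZl mulrAC.
apply: canRL (mulfK _) _; first by case: sP.
exact: (potential_unique incidence_neq0 i ord0 sP qP).
Qed.

End Corner.

(** Complementation maps 2-faces to 2-faces and reverses the inclusions, which
    turns the cyclic order of the vertices by two steps. *)
Lemma flat_face_setC (K : fieldType) m (y : {set 'I_m.+3} -> 'rV[K]_m.+3)
    (I : {set 'I_m.+3}) j k :
  j \notin I -> k \notin I -> j != k ->
  flat_face y I j k <-> flat_face (fun J => y (~: J)) (~: (k |: (j |: I))) j k.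
Proof.
move=> jI kI jk; rewrite /flat_face /=.
have compl (A : {set 'I_m.+3}) x : x \notin A -> x |: ~: (x |: A) = ~: A.
  move=> xA; apply/setP => z; rewrite !inE.
  by case: eqVneq => // ->; rewrite xA.
have kjI : k \notin j |: I by rewrite !inE eq_sym negb_or jk.
have jkI : j \notin k |: I by rewrite !inE negb_or jk.
have -> : j |: ~: (k |: (j |: I)) = ~: (k |: I) by rewrite setUCA compl.
rewrite !compl // !setCK.
by split=> /flat_rot/flat_rot.
Qed.

(** * Homogeneous coordinates *)

Section Tiles.
Variable K : fieldType.
Implicit Types (u v w z a b : 'rV[K]_4) (A : psubspace K).

Lemma mem_plane_of w u : (u \in plane_of w) = (dot u w == 0).
Proof.
rewrite memv_ker lfunE /=; apply/eqP/eqP => [uw|uw]; first by rewrite /dot uw mxE.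
by apply/matrixP => i j; rewrite !ord1 [RHS]mxE.
Qed.

(** If [u] and [v] span distinct points, the line through them meets the plane of
    [w] in the single point [t = <u, w> v - <v, w> u], so that it meets the line
    common to the planes of [w] and [z] iff [t] lies on the plane of [z], which is
    the equation of [flat].  The equation also holds if the two points or the two
    planes coincide. *)
Lemma coherentP u w v z : u != 0 -> v != 0 ->
  coherent <[u]>%VS (plane_of w) <[v]>%VS (plane_of z) <-> flat u w v z.
Proof.
move=> u0 v0; rewrite /coherent -!memvE !mem_plane_of /flat.
rewrite (dotC w v) (dotC z u); split.
- case=> -[uw uz vw vz] H; split=> //.
  case: H => [uv|wz|/eqP].
  + have /vlineP[k ->] : u \in <[v]>%VS by rewrite -uv memv_line.
    by rewrite !dotZl; ring.
  + have : dot u w *: v - dot v w *: u \in plane_of w.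
      by rewrite mem_plane_of -scaleNr dotDl !dotZl mulrC mulNr subrr.
    rewrite wz mem_plane_of -scaleNr dotDl !dotZl mulNr subr_eq0.
    by move/eqP.
  + move=> X0; set X := (_ :&: _)%VS in X0.
    have := memv_pick X; rewrite memv_cap => /andP[/memv_addP[x xu [y yv e]]].
    have : vpick X != 0 by rewrite vpick0.
    move: xu yv e => /vlineP[k ->] /vlineP[h ->] ->.
    rewrite memv_cap !mem_plane_of !dotDl !dotZl => n0 /andP[/eqP ew /eqP ez].
    have [h0|h0] := eqVneq h 0.
      move: n0 ew; rewrite h0 mul0r addr0 scale0r addr0 scaler_eq0 negb_or.
      by case/andP=> k0 _ /eqP; rewrite mulf_eq0 (negbTE k0) (negbTE uw).
    apply: (mulfI h0).
    have {}ew : h * dot v w = - (k * dot u w).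
      by apply/eqP; rewrite eq_sym -subr_eq0 -opprD oppr_eq0 ew.
    have {}ez : h * dot v z = - (k * dot u z).
      by apply/eqP; rewrite eq_sym -subr_eq0 -opprD oppr_eq0 ez.
    by rewrite mulrCA ez mulrA ew; ring.
- case=> uw vw vz uz e; split=> //.
  pose t := dot u w *: v - dot v w *: u.
  have [/eqP|t0] := eqVneq t 0.
    rewrite subr_eq0 => /eqP vu; constructor 1; apply/eqP.
    rewrite eqEdim !dim_vline u0 v0 leqnn andbT -memvE.
    have -> : u = (dot v w)^-1 *: (dot v w *: u) by rewrite scalerK.
    by rewrite -vu !memvZ ?memv_line.
  constructor 3 => X0.
  have : t \in ((<[u]> + <[v]>) :&: (plane_of w :&: plane_of z))%VS.
    rewrite !memv_cap !mem_plane_of; apply/and3P; split.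
    - by rewrite /t addrC -scaleNr memv_add // memvZ // memv_line.
    - by rewrite /t -scaleNr dotDl !dotZl mulrC mulNr subrr.
    - by rewrite /t -scaleNr dotDl !dotZl mulNr subr_eq0 e.
  by rewrite X0 memv0 (negbTE t0).
Qed.

Lemma point_coordinates A : is_point A -> exists2 u, u != 0 & A = <[u]>%VS.
Proof.
move=> /eqP dA.
have A0 : vpick A != 0 by rewrite vpick0 -dimv_eq0 dA.
exists (vpick A) => //; apply/eqP.
by rewrite eq_sym eqEdim -memvE memv_pick dA dim_vline A0.
Qed.

Lemma is_point_vline u : u != 0 -> is_point <[u]>%VS.
Proof. by move=> u0; rewrite /is_point dim_vline u0. Qed.

(** A nonzero linear form has rank 1, hence a kernel of dimension 3. *)
Lemma is_plane_of w : w != 0 -> is_plane (plane_of w).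
Proof.
move=> w0; rewrite /is_plane /plane_of; set f := linfun _.
have := limg_ker_dim f fullv; rewrite capfv dimvf.
have fE u : f u = dot u w *: 1%:M.
  by rewrite lfunE /=; apply/matrixP => i j; rewrite !ord1 [RHS]mxE [X in _ * X]mxE eqxx mulr1.
have -> : \dim (limg f) = 1%N.
  have [i wi] : exists i, w 0 i != 0.
    by apply/existsP; apply: contraNT w0 => /existsPn w0;
       apply/eqP/rowP => i; rewrite mxE; apply/eqP; rewrite -[_ == _]negbK.
  have -> : limg f = <[1%:M]>%VS.
    apply/eqP; rewrite eqEsubv; apply/andP; split.
      by apply/subvP => _ /memv_imgP[u _ ->]; rewrite fE memvZ ?memv_line.
    rewrite -memvE.
    (* A vector on which the form takes the value 1. *)
    have -> : 1%:M = f ((w 0 i)^-1 *: delta_mx 0 i).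
      rewrite fE dotZl /dot -rowE !mxE mulVf ?scale1r //.
    exact: memv_img (memvf _).
  by rewrite dim_vline oner_neq0.
by rewrite addn1 => -[->].
Qed.

Definition subspace_at (I : {set 'I_4}) u : psubspace K :=
  if odd #|I| then plane_of u else <[u]>%VS.

(** At an odd [I] the tile is listed from the point after [I], which amounts to
    a rotation of the cyclic order used by [flat_face]. *)
Lemma face_coherentP f (y : {set 'I_4} -> 'rV[K]_4) (I : {set 'I_4}) j k :
  (forall J, y J != 0) -> (forall J, f J = subspace_at J (y J)) ->
  is_face I j k -> face_coherent f I j k <-> flat_face y I j k.
Proof.
move=> y0 fE /and3P[jI kI jk].
have kjI : k \notin j |: I by rewrite !inE eq_sym negb_or jk.
rewrite /face_coherent /flat_face !fE /subspace_at.
rewrite (cardsU1 _ (j |: I)) kjI !cardsU1 jI kI /=.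
case: (odd #|I|) => /=; rewrite coherentP //.
by split=> [/flat_rot/flat_rot/flat_rot|/flat_rot].
Qed.

End Tiles.

(** * The faces of the 4-cube *)

Section FourCube.
Variable K : fieldType.
Implicit Types (x : input_vertex -> 'rV[K]_4) (y : {set 'I_4} -> 'rV[K]_4).
Implicit Types (a b : 'rV[K]_4) (I J : {set 'I_4}) (c : inputs K).

Lemma flat_face_opposite y I j k : is_face I j k ->
  is_face (~: (k |: (j |: I))) j k /\
  (flat_face y (~: (k |: (j |: I))) j k -> flat_face (fun J => y (~: J)) I j k).
Proof.
move=> /and3P[jI kI jk]; split; first by rewrite /is_face !inE !eqxx orbT.
move=> yF; apply/(flat_face_setC _ jI kI jk).
by move: yF; rewrite /flat_face !setCK.
Qed.

Lemma card_opposite I j k :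
  is_face I j k -> (#|I| + #|~: (k |: (j |: I))| = 2)%N.
Proof.
move=> /and3P[jI kI jk].
have kjI : k \notin j |: I by rewrite !inE eq_sym negb_or jk.
have := cardsC (k |: (j |: I)); rewrite !cardsU1 kjI jI card_ord.
by rewrite !add1n !addSn => -[].
Qed.

Lemma is_face_set1 i j k :
  is_face [set i] j k = [&& i != j, i != k & j != k].
Proof. by rewrite /is_face !inE !(eq_sym i). Qed.

Lemma flat_middle_setC y : flat_middle y -> flat_middle (fun J => y (~: J)).
Proof.
move=> yP i j k ij ik jk.
have iF : is_face [set i] j k by rewrite is_face_set1 ij ik.
have [oF] := flat_face_opposite y iF; apply.
have /eqP := card_opposite iF; rewrite cards1 eqSS => /cards1P[l lE].
by move: oF; rewrite lE is_face_set1 => /and3P[]; apply: yP.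
Qed.

(** The faces [I, I + j, I + j + k, I + k] are sorted by the cardinal of [I],
    which is 0, 1 or 2; in the last case the complement of the face starts at
    [set0]. *)
Lemma flat_facesP y :
  (forall I j k, is_face I j k -> flat_face y I j k) <->
  [/\ flat_corner y (y set0), flat_middle y
    & flat_corner (fun J => y (~: J)) (y setT)].
Proof.
have corner (z : {set 'I_4} -> 'rV[K]_4) : flat_corner z (z set0) <->
    forall j k, j != k -> flat_face z set0 j k.
  by split=> zP j k /zP; rewrite /flat_face !setU0.
have := corner (fun J => y (~: J)); rewrite {1}setC0 => cornerC.
have face0 j k : j != k -> is_face set0 j k by rewrite /is_face !inE.
split=> [yP|[/corner y0 y1 /cornerC y2] I j k IF].
  split=> [|i j k ij ik jk|].
  - by apply/corner => j k jk; apply/yP/face0.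
  - by apply: yP; rewrite is_face_set1 ij ik.
  - apply/cornerC => j k /face0 jkF.
    by have [/yP oF] := flat_face_opposite y jkF; apply.
have [jI kI jk] := and3P IF.
have := card_opposite IF; case E: #|I| => [|[|n]] => [_|_|/eqP].
- by rewrite (cards0_eq E); apply: y0.
- have /cards1P[i Ii] : #|I| == 1%N by rewrite E.
  by move: IF; rewrite Ii is_face_set1 => /and3P[]; apply: y1.
- rewrite !addSn !eqSS addn_eq0 => /andP[_]; rewrite cards_eq0 => /eqP oE.
  by apply/(flat_face_setC _ jI kI jk); rewrite oE; apply: y2.
Qed.

(** The vectors of the labels of the whole cube, given those of the inputs and
    of the two remaining vertices. *)
Definition vector_at x a b I : 'rV[K]_4 :=
  if insub I is Some v then x v else if I == set0 then a else b.

Definition inner I := (I != set0) && (I != setT).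

Lemma vector_at_inner x a b a' b' I :
  inner I -> vector_at x a b I = vector_at x a' b' I.
Proof. by move=> In; rewrite /vector_at insubT. Qed.

Lemma extend_inner c A B A' B' I :
  inner I -> extend c A B I = extend c A' B' I.
Proof. by move=> In; rewrite /extend insubT. Qed.

Lemma inner_card I : inner I = (0 < #|I| < 4)%N.
Proof.
rewrite /inner -cards_eq0 -lt0n; congr (_ && _).
by rewrite eqEcard subsetT cardsT card_ord /= -ltnNge.
Qed.

Lemma inner_face I j k J : #|I| = 1%N -> is_face I j k ->
  J \in [:: I; j |: I; k |: (j |: I); k |: I] -> inner J.
Proof.
move=> I1 /and3P[jI kI jk].
have kjI : k \notin j |: I by rewrite !inE eq_sym negb_or jk.
rewrite inner_card !inE => /or4P[] /eqP->.
all: by rewrite ?cardsU1 ?kjI ?cardsU1 ?jI ?kI I1.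
Qed.

Lemma flat_face_eq y z I j k :
  (forall J, J \in [:: I; j |: I; k |: (j |: I); k |: I] -> y J = z J) ->
  flat_face y I j k -> flat_face z I j k.
Proof. by move=> yz; rewrite /flat_face !yz ?inE ?eqxx ?orbT. Qed.

Lemma face_coherent_eq (f g : labeling K) I j k :
  (forall J, J \in [:: I; j |: I; k |: (j |: I); k |: I] -> f J = g J) ->
  face_coherent f I j k -> face_coherent g I j k.
Proof. by move=> fg; rewrite /face_coherent !fg ?inE ?eqxx ?orbT. Qed.

Lemma flat_corner_eq y z a :
  (forall J, inner J -> y J = z J) -> flat_corner y a -> flat_corner z a.
Proof.
move=> yz yP i j ij; have := yP i j ij.
by rewrite !yz // inner_card ?cards1 // cards2; case: (_ != _).
Qed.

Section Coordinates.
Variables (c : inputs K) (x : input_vertex -> 'rV[K]_4).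
Hypothesis x_coords : homogeneous_coordinates c x.

Lemma extend_subspace a b J :
  extend c <[a]>%VS <[b]>%VS J = subspace_at J (vector_at x a b J).
Proof.
rewrite /extend /vector_at /subspace_at.
case: insubP => [v _ <-|]; first exact: (x_coords v).2.
rewrite negb_and !negbK; case: eqVneq => [-> _|_ /eqP->].
  by rewrite cards0.
by rewrite cardsT card_ord.
Qed.

Lemma vector_at_neq0 a b J : a != 0 -> b != 0 -> vector_at x a b J != 0.
Proof.
move=> a0 b0; rewrite /vector_at; case: insub => [v|]; last by case: ifP.
exact: (x_coords v).1.
Qed.

Lemma vector_at0 a b : vector_at x a b set0 = a.
Proof. by rewrite /vector_at insubF ?eqxx. Qed.

Lemma vector_atT a b : vector_at x a b setT = b.
Proof.
rewrite /vector_at insubF ?eqxx ?andbF //.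
by rewrite -cards_eq0 cardsT card_ord.
Qed.

Lemma configuration_flat a b :
  configuration c -> flat_middle (vector_at x a b).
Proof.
move=> [_ cP] i j k ij ik jk.
have iF : is_face [set i] j k by rewrite is_face_set1 ij ik.
have inI := inner_face (cards1 i) iF.
(* Nonzero vectors at the two extreme vertices make every label of the cube the
   subspace described by its vector. *)
have e0 : (delta_mx 0 0 : 'rV[K]_4) != 0.
  by apply/eqP => /matrixP/(_ 0 0)/eqP; rewrite !mxE oner_eq0.
apply: (@flat_face_eq (vector_at x (delta_mx 0 0) (delta_mx 0 0))).
  by move=> J /inI/vector_at_inner.
apply/(face_coherentP _ (extend_subspace _ _) iF).
  by move=> J; apply: vector_at_neq0.
apply: face_coherent_eq (cP _ _ _ (cards1 i) iF) => J /inI.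
exact: extend_inner.
Qed.

(** The two unknown vertices decouple, and the faces between the inputs are
    coherent by assumption.  The right-hand side uses one fixed family of
    vectors, with [0] at the two unknown vertices, so that it can be compared for
    different [a] and [b]. *)
Lemma completes_cubeP a b : configuration c -> a != 0 -> b != 0 ->
  completes_cube c (<[a]>%VS, <[b]>%VS) <->
  flat_corner (vector_at x 0 0) a /\
  flat_corner (fun J => vector_at x 0 0 (~: J)) b.
Proof.
move=> cP a0 b0.
have x0 J : vector_at x a b J != 0 by apply: vector_at_neq0.
have innerC J : inner (~: J) = inner J.
  rewrite /inner -(inj_eq (@setC_inj _) _ set0) -(inj_eq (@setC_inj _) _ setT).
  by rewrite setCK setC0 setCT andbC.
have facesP : (forall I j k, is_face I j k ->
    face_coherent (extend c <[a]>%VS <[b]>%VS) I j k) <->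
    (forall I j k, is_face I j k -> flat_face (vector_at x a b) I j k).
  split=> H I j k IF; have := H I j k IF;
    by move/(face_coherentP x0 (extend_subspace a b) IF).
have := flat_facesP (vector_at x a b); rewrite vector_at0 vector_atT => cubeP.
split=> [[_ _ /facesP/cubeP[A _ B]]|[A B]].
  split; [apply: flat_corner_eq A|apply: flat_corner_eq B] => J inJ;
    by apply: vector_at_inner; rewrite ?innerC.
split; [exact: is_point_vline|exact: is_point_vline|apply/facesP/cubeP].
split; last 1 first.
- by apply: flat_corner_eq B => J inJ; apply: vector_at_inner; rewrite ?innerC.
- by apply: flat_corner_eq A => J inJ; apply: vector_at_inner.
- exact: configuration_flat.
Qed.

End Coordinates.

Lemma vector_at_val x a b (v : input_vertex) : vector_at x a b (val v) = x v.
Proof. by rewrite /vector_at valK. Qed.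

Lemma inner_set1 i : inner [set i].
Proof. by rewrite inner_card cards1. Qed.

Lemma inner_setC1 i : inner (~: [set i]).
Proof. by rewrite inner_card cardsC1 card_ord. Qed.

(** * The open set of configurations in general position *)

Definition lower_plane i : input_vertex := Sub [set i] (inner_set1 i).
Definition upper_plane i : input_vertex := Sub (~: [set i]) (inner_setC1 i).

Lemma unique_completion c x : configuration c -> homogeneous_coordinates c x ->
  \matrix_i x (lower_plane i) \in unitmx ->
  \matrix_i x (upper_plane i) \in unitmx ->
  exists! AB, completes_cube c AB.
Proof.
move=> cP xP lowP upP; set y := vector_at x 0 0.
have yP : flat_middle y by apply: configuration_flat.
have lowE : \matrix_i x (lower_plane i) = \matrix_i y [set i].
  by apply/matrixP => i j; rewrite !mxE -(vector_at_val x 0 0).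
have upE : \matrix_i x (upper_plane i) = \matrix_i y (~: [set i]).
  by apply/matrixP => i j; rewrite !mxE -(vector_at_val x 0 0).
rewrite lowE in lowP; rewrite upE in upP.
have [p [pP p_uniq]] := flat_corner_exists yP lowP.
have [q [qP q_uniq]] := flat_corner_exists (flat_middle_setC yP) upP.
have corner_neq0 (z : {set 'I_4} -> 'rV[K]_4) u : flat_corner z u -> u != 0.
  move=> zP; apply: contraTneq isT => u0.
  by have [] := zP 0 1 isT; rewrite u0 dot0l eqxx.
have p0 := corner_neq0 _ _ pP; have q0 := corner_neq0 _ _ qP.
have line_eq (u v : 'rV[K]_4) k : u != 0 -> v = k *: u -> v != 0 ->
    <[u]>%VS = <[v]>%VS.
  move=> u0 -> ku0; apply/eqP; rewrite eq_sym eqEdim !dim_vline u0 ku0 leqnn.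
  by rewrite andbT -memvE memvZ ?memv_line.
exists (<[p]>%VS, <[q]>%VS); split.
  by apply/(completes_cubeP xP cP p0 q0).
case=> A B AB; have [/= /point_coordinates[a a0 Aa] /point_coordinates[b b0 Bb] _] := AB.
move: AB; rewrite {}Aa {}Bb => /(completes_cubeP xP cP a0 b0)[/p_uniq[k ak] /q_uniq[h bh]].
by rewrite (line_eq p a k) // (line_eq q b h).
Qed.

Definition coordinate_matrix (v : 'I_4 -> input_vertex) :
    'M[coordinate_poly K]_4 :=
  \matrix_(i, s) 'X_(enum_rank (v i, s)).

Lemma eval_det_coordinates x v :
  eval_at x (\det (coordinate_matrix v)) = \det (\matrix_i x (v i)).
Proof.
rewrite /eval_at -det_map_mx; congr (\det _); apply/matrixP => i s.
by rewrite !mxE [LHS]mevalXU enum_rankK.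
Qed.

Definition general_position_poly : coordinate_poly K :=
  \det (coordinate_matrix lower_plane) * \det (coordinate_matrix upper_plane).

(** Asking for the vanishing at all coordinates of [c] makes the locus closed by
    definition; its complement is where some choice of coordinates gives
    independent planes. *)
Definition degenerate c : Prop :=
  forall x, homogeneous_coordinates c x -> eval_at x general_position_poly = 0.

Lemma degenerate_closed : zariski_closed degenerate.
Proof.
exists [:: general_position_poly] => c _.
by split=> H x /H xP => [g|]; [rewrite inE => /eqP->|apply: xP; rewrite inE].
Qed.

Lemma eval_general_position x :
  (eval_at x general_position_poly != 0) =
  (\matrix_i x (lower_plane i) \in unitmx) &&
  (\matrix_i x (upper_plane i) \in unitmx).
Proof.
by rewrite /eval_at mevalM -!/(eval_at _ _) !eval_det_coordinates mulf_eq0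
  negb_or !unitmxE !unitfE.
Qed.

(** * A configuration in general position *)

Definition indicator I : 'rV[K]_4 := \row_s (s \in I)%:R.

Lemma dot_indicator I : dot (indicator setT) (indicator I) = #|I|%:R.
Proof.
rewrite /dot mxE (eq_bigr (fun s => (s \in I)%:R)) => [|s _]; last first.
  by rewrite !mxE inE mul1r.
rewrite -natr_sum -sum1_card [in RHS]big_mkcond /=.
by congr _%:R; apply: eq_bigr => s _; case: (s \in I).
Qed.

(** All points are [(1 : 1 : 1 : 1)], and the plane at [[set i]] and the plane at
    its complement are both the coordinate plane [x_i = 0]; every product of a
    point and a plane is then 1. *)
Definition sample_vector I : 'rV[K]_4 :=
  if ~~ odd #|I| then indicator setT
  else if #|I| == 1%N then indicator I else indicator (~: I).

Definition sample_inputs : inputs K :=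
  fun v => subspace_at (val v) (sample_vector (val v)).

Lemma dot_sample I J : odd #|I| -> ~~ odd #|J| ->
  dot (sample_vector J) (sample_vector I) = 1.
Proof.
rewrite /sample_vector => oI ->; rewrite oI /=.
case: ifP => [/eqP I1|I1]; rewrite dot_indicator ?I1 //.
have := cardsC I; rewrite card_ord.
by case: #|I| oI I1 => [|[|[|[|[|n]]]]] //= _ _ []; rewrite ?add0n => ->.
Qed.

Lemma sample_vector_neq0 I : sample_vector I != 0.
Proof.
apply: contraTneq isT => I0; have := oner_neq0 K.
have [oI|eI] := boolP (odd #|I|).
  by rewrite -(@dot_sample I set0) ?cards0 // I0 dotC dot0l eqxx.
by rewrite -(@dot_sample [set 0] I) ?cards1 // I0 dot0l eqxx.
Qed.

Lemma sample_coordinates :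
  homogeneous_coordinates sample_inputs (sample_vector \o val).
Proof. by move=> v; split; first exact: sample_vector_neq0. Qed.

Lemma sample_configuration : configuration sample_inputs.
Proof.
split=> [v|I j k I1 IF].
  rewrite /sample_inputs /subspace_at; have := sample_vector_neq0 (val v).
  by case: ifP => o n0; rewrite ?o; [apply: is_plane_of|apply: is_point_vline].
apply: (@face_coherent_eq (fun J => subspace_at J (sample_vector J))).
  by move=> J /(inner_face I1 IF) inJ; rewrite /extend insubT.
apply/(face_coherentP sample_vector_neq0 _ IF) => //.
have [jI kI jk] := and3P IF.
have kjI : k \notin j |: I by rewrite !inE eq_sym negb_or jk.
have [I_odd J_even] : odd #|I| /\ ~~ odd #|j |: I| by rewrite cardsU1 jI I1.
have [T_odd L_even] : odd #|k |: (j |: I)| /\ ~~ odd #|k |: I|.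
  by rewrite !cardsU1 kjI jI kI I1.
rewrite /flat_face /flat (dotC (sample_vector I)) (dotC _ (sample_vector (k |: I))).
by rewrite !dot_sample // oner_neq0.
Qed.

(** * Generic unique completion *)

Lemma generic_completion : exists U : inputs K -> Prop,
  [/\ zariski_open_in (@configuration K) U, exists c, U c &
      forall c, U c -> exists! AB, completes_cube c AB].
Proof.
exists (fun c => configuration c /\ ~ degenerate c); split.
- by exists degenerate => //; apply: degenerate_closed.
- exists sample_inputs; split; first exact: sample_configuration.
  move=> /(_ _ sample_coordinates)/eqP; apply/negP; rewrite eval_general_position.
  have ind1 : \matrix_i indicator [set i] = 1%:M.
    by apply/matrixP => i s; rewrite !mxE !inE eq_sym.
  have -> : \matrix_i (sample_vector \o val) (lower_plane i) = 1%:M.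
    rewrite -ind1; apply/row_matrixP => i.
    by rewrite !rowK /= /sample_vector cards1.
  have -> : \matrix_i (sample_vector \o val) (upper_plane i) = 1%:M.
    rewrite -ind1; apply/row_matrixP => i.
    by rewrite !rowK /= /sample_vector cardsC1 card_ord setCK.
  by rewrite unitmx1.
- move=> c [cP /existsNP[x /not_implyP[xP /eqP]]].
  rewrite eval_general_position => /andP[lowP upP].
  exact: unique_completion cP xP lowP upP.
Qed.

End FourCube.

Theorem theorem9p8 (R : realType) :
  (exists U : inputs R -> Prop,
     [/\ zariski_open_in (@configuration R) U, exists c, U c &
         forall c, U c -> exists! AB, completes_cube c AB]) /\
  (exists U : inputs R[i] -> Prop,
     [/\ zariski_open_in (@configuration R[i]) U, exists c, U c &
         forall c, U c -> exists! AB, completes_cube c AB]).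
Proof. by split; apply: generic_completion. Qed.
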